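(* Let $\mathcal{G}=(\mathcal{V},\mathcal{E},\mathbf{W})$ be a connected signed weighted undirected graph with Laplacian matrix $L$, and let $\mathcal{V}_-=\{i\in\mathcal{V}: \exists (i,j)\in\mathcal{E} \text{ with } w_{ij}<0\}$. The following statements are equivalent: (a) $L$ is positive semi-definite with only one zero eigenvalue. (b) There exists a sequential inclusion $\{\mathcal{V}_-^k\}$ of $\mathcal{V}_-$ such that $g_{\mathrm{eff}}(L,\mathcal{V}_-^{k+1}\setminus\mathcal{V}_-^k,\mathcal{V}_-^k)>0$ for $k=1,2,\dots,|\mathcal{V}_-|-1$. (c) There exist a set $\mathcal{V}_o\subset\mathcal{V}$ and a sequential inclusion $\{\mathcal{V}_r^k\}$ of $\mathcal{V}_r=\mathcal{V}\setminus\mathcal{V}_o$ such that $L_{oo}$ (the principal submatrix of $L$ with rows and columns indexed by $\mathcal{V}_o$) is positive definite and $g_{\mathrm{eff}}(L,\mathcal{V}_r^{k+1}\setminus\mathcal{V}_r^k,\mathcal{V}_r^k)>0$ for $k=1,2,\dots,|\mathcal{V}_r|-1$.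
   Context: Graph: $\mathcal{G}=(\mathcal{V},\mathcal{E},\mathbf{W})$ is a simple undirected connected graph with finite node set $\mathcal{V}$, $n=|\mathcal{V}|$, edge set $\mathcal{E}$, $l=|\mathcal{E}|$; each edge $(i,j)$ carries a nonzero real weight $w_{ij}$, positive or negative, and $\mathbf{W}\in\mathbb{R}^{l\times l}$ is the diagonal matrix of edge weights. With the edges arbitrarily oriented, $\mathbf{E}\in\mathbb{R}^{n\times l}$ is the incidence matrix (column of an edge from $i$ to $j$: entry $1$ in row $i$, $-1$ in row $j$, $0$ elsewhere). The Laplacian is $L=\mathbf{E}\mathbf{W}\mathbf{E}^T$ (real symmetric with zero row sums). ''Positive semi-definite with only one zero eigenvalue'' means $L\succeq 0$ and $0$ is a simple eigenvalue. Effective conductance: for non-empty disjoint $\mathcal{V}_a,\mathcal{V}_b\subset\mathcal{V}$ put $\mathcal{V}_c=\mathcal{V}\setminus(\mathcal{V}_a\cup\mathcal{V}_b)$, $a=|\mathcal{V}_a|$, $b=|\mathcal{V}_b|$, and let $L_{xy}$ be the submatrix of $L$ with rows indexed by $\mathcal{V}_x$ and columns by $\mathcal{V}_y$. If $L_{cc}$ is nonsingular, let $L/L_{cc}$ be the Schur complement $$L/L_{cc}=\begin{bmatrix}L_{aa}&L_{ab}\\L_{ab}^T&L_{bb}\end{bmatrix}-\begin{bmatrix}L_{ac}\\L_{bc}\end{bmatrix}L_{cc}^{-1}\begin{bmatrix}L_{ac}^T&L_{bc}^T\end{bmatrix},$$ with $L/L_{cc}=L$ if $\mathcal{V}_c=\emptyset$.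 Then $g_{\mathrm{eff}}(L,\mathcal{V}_a,\mathcal{V}_b)=\mathbf{e}_{\mathcal{V}_a}^T(L/L_{cc})\mathbf{e}_{\mathcal{V}_a}$, where $\mathbf{e}_{\mathcal{V}_a}\in\mathbb{R}^{a+b}$ has entries $1$ on $\mathcal{V}_a$ and $0$ on $\mathcal{V}_b$. Whenever $g_{\mathrm{eff}}$ is mentioned it is implicitly meant that the corresponding $L_{cc}$ is nonsingular; in particular ''$g_{\mathrm{eff}}(\cdot)>0$'' means that the corresponding $L_{cc}$ is nonsingular and the value is positive. Sequential inclusion: for a set $\mathcal{U}$ with $|\mathcal{U}|=m$, a family of subsets $\mathcal{U}^1\subset\mathcal{U}^2\subset\dots\subset\mathcal{U}^m=\mathcal{U}$ with $|\mathcal{U}^{k+1}|-|\mathcal{U}^k|=1$ for $k=1,\dots,m-1$. Conventions: if $\mathcal{V}_-=\emptyset$, (b) is regarded as vacuously true; in (c) the set $\mathcal{V}_o$ may be empty (then the condition on $L_{oo}$ is void), and $\mathcal{V}_o\ne\mathcal{V}$. *)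

(* Defs.v *)
From mathcomp Require Import all_boot all_order all_algebra.
From mathcomp Require Import reals.

Set Implicit Arguments.
Unset Strict Implicit.
Unset Printing Implicit Defensive.

Import Order.TTheory GRing.Theory Num.Theory.
Local Open Scope ring_scope.

(* The nodes are 'I_n and the edges 'I_l.  The edge e joins src e and dst e; the
   choice of which end is the source is the arbitrary orientation that enters
   the incidence matrix.  The last two fields say that the undirected graph is
   simple: it has no loop and no two edges with the same pair of ends. *)
Record signed_graph (R : realType) (n l : nat) := SignedGraph {
  src : 'I_l -> 'I_n;
  dst : 'I_l -> 'I_n;
  wt : 'I_l -> R;
  wt_neq0 : forall e, wt e != 0;
  src_neq_dst : forall e, src e != dst e;
  ends_inj : injective (fun e => [set src e; dst e]) }.

Section Graph.
Variables (R : realType) (n l : nat) (G : signed_graph R n l).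

Definition ends (e : 'I_l) : {set 'I_n} := [set src G e; dst G e].

Definition adjacent : rel 'I_n := fun i j => [exists e, ends e == [set i; j]].

Definition connected_graph : Prop :=
  (0 < n)%N /\ forall i j : 'I_n, connect adjacent i j.

Definition incidence : 'M[R]_(n, l) :=
  \matrix_(i < n, e < l)
    (if i == src G e then 1 else if i == dst G e then -1 else 0).

Definition weight_matrix : 'M[R]_l := diag_mx (\row_(e < l) wt G e).

Definition laplacian : 'M[R]_n := incidence *m weight_matrix *m incidence^T.

Definition negative_nodes : {set 'I_n} :=
  [set i | [exists e, (i \in ends e) && (wt G e < 0)]].

End Graph.

Section Matrices.
Variables (R : realType) (n : nat).

Definition pos_semidef (A : 'M[R]_n) : Prop :=
  A^T = A /\ forall x : 'cV[R]_n, 0 <= (x^T *m A *m x) 0 0.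

Definition pos_def (A : 'M[R]_n) : Prop :=
  A^T = A /\ forall x : 'cV[R]_n, x != 0 -> 0 < (x^T *m A *m x) 0 0.

(* Algebraic multiplicity. *)
Definition simple_eigenvalue (A : 'M[R]_n) (a : R) : Prop :=
  mup a (char_poly A) = 1%N.

(* Rows in X, columns in Y, both listed in increasing order. *)
Definition submat (A : 'M[R]_n) (X Y : {set 'I_n}) : 'M[R]_(#|X|, #|Y|) :=
  mxsub (@enum_val _ (mem X)) (@enum_val _ (mem Y)) A.

End Matrices.

Section Conductance.
Variables (R : realType) (n : nat) (L : 'M[R]_n) (Va Vb : {set 'I_n}).

Definition rest : {set 'I_n} := ~: (Va :|: Vb).

(* When rest = set0, the block indexed by it is the 0 x 0 matrix, which lies in
   unitmx, and the subtracted product is 0. *)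
Definition schur : 'M[R]_(#|Va| + #|Vb|) :=
  block_mx (submat L Va Va) (submat L Va Vb)
           (submat L Va Vb)^T (submat L Vb Vb)
  - col_mx (submat L Va rest) (submat L Vb rest)
    *m invmx (submat L rest rest)
    *m row_mx (submat L Va rest)^T (submat L Vb rest)^T.

Definition ind_a : 'cV[R]_(#|Va| + #|Vb|) := col_mx (const_mx 1) (const_mx 0).

Definition g_eff : R := (ind_a^T *m schur *m ind_a) 0 0.

(* invmx is total, so the nonsingularity implicit in every mention of g_eff has
   to be required separately. *)
Definition g_eff_gt0 : Prop := submat L rest rest \in unitmx /\ 0 < g_eff.

End Conductance.

(* Only the values F 1, ..., F m with m = #|U| matter.  For U = set0 the
   condition reduces to F 0 = set0, so a sequential inclusion exists. *)
Definition sequential_inclusion (T : finType) (U : {set T})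
    (F : nat -> {set T}) : Prop :=
  (forall k, (1 <= k < #|U|)%N ->
     F k \subset F k.+1 /\ #|F k.+1| = #|F k|.+1) /\
  F #|U| = U.

(* Main.v *)
Require Import Defs.
From mathcomp Require Import all_boot all_order all_algebra.
From mathcomp Require Import boolp reals ring.

(** Everything is read off the quadratic form x |-> x^T L x, which equals the
    sum over the edges of w_e (x_src - x_dst)^2 [quad_laplacian].  It does not
    change when a constant vector is added to x, because L is symmetric and
    kills constants.

    Statement (a) says that this form is positive off the constant vectors
    [psd_simple0P].  Since constants can be subtracted freely, this is the same
    as positivity on the vectors vanishing at one given node
    [pos_mod_const_grounded], and it implies positivity on the vectors
    supported on any proper subset of nodes [pos_mod_const_on], that is,
    positive definiteness of every proper principal submatrix
    [pos_def_submatP].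

    An effective conductance is the value of the form at one vector, the
    potential that is 1 on Va, 0 on Vb and L-harmonic elsewhere [g_eff_quad].
    For Va = {v}, a vector vanishing on Vb is the sum of a multiple of that
    potential and of a vector supported off v and Vb, and the two summands are
    L-orthogonal.  Hence, if L is positive definite off v and Vb, a positive
    conductance is what extends the positivity to v [pos_on_grow].  Going down
    a sequential inclusion of U from the complement of U, one node at a time,
    ends with a single grounded node [pos_on_chain]; this derives (a) from (c).
    In the other direction, the potential is a nonzero vector vanishing on a
    nonempty set, so its conductance is positive as soon as (a) holds
    [pos_mod_const_g_eff]; this derives (b) from (a), and a one-node sequential
    inclusion derives (c) from (a).

    Finally, (b) starts from a set where positivity is free: on vectors
    vanishing at all ends of negative edges only the positive edges contribute
    to the edge sum, and by connectedness the sum vanishes only for constants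
    [quad_laplacian_gt0].  So (b) gives (a) by the descent used for (c), with U
    the set of nodes on negative edges; when there are no negative edges, the
    edge sum gives (a) directly. *)

Set Implicit Arguments.
Unset Strict Implicit.
Unset Printing Implicit Defensive.

Import Order.TTheory GRing.Theory Num.Theory.
Local Open Scope ring_scope.

(** * Quadratic forms and constant vectors *)

Section SquaredNorm.
Variables (R : realFieldType) (n : nat).
Implicit Type x : 'cV[R]_n.

Lemma norm2E x : (x^T *m x) 0 0 = \sum_i x i 0 ^+ 2.
Proof. by rewrite mxE; apply: eq_bigr => i _; rewrite !mxE expr2. Qed.

Lemma norm2_ge0 x : 0 <= (x^T *m x) 0 0.
Proof. by rewrite norm2E sumr_ge0 // => i _; apply: sqr_ge0. Qed.

Lemma norm2_eq0 x : ((x^T *m x) 0 0 == 0) = (x == 0).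
Proof.
apply/eqP/eqP=> [|->]; last by rewrite mulmx0 mxE.
move=> /eqP; rewrite norm2E psumr_eq0 => [/allP x0|i _]; last exact: sqr_ge0.
apply/matrixP=> i j; rewrite [j]ord1 [RHS]mxE; apply/eqP.
by have := x0 i (mem_index_enum _); rewrite sqrf_eq0.
Qed.

End SquaredNorm.

Section QuadraticForms.
Variables (R : realFieldType) (n : nat).
Implicit Types (A : 'M[R]_n) (x y : 'cV[R]_n) (S : {set 'I_n}).

Definition quad A x : R := (x^T *m A *m x) 0 0.

(** Positive definiteness of the principal submatrix on S, phrased on full-length
    vectors so that different sets S can be compared without reindexing. *)
Definition pos_on A S : Prop :=
  forall x, (forall i, i \notin S -> x i 0 = 0) -> x != 0 -> 0 < quad A x.

Definition pos_mod_const A : Prop :=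
  forall x, (forall c, x != const_mx c) -> 0 < quad A x.

Lemma quadD A x y : A^T = A ->
  quad A (x + y) = quad A x + 2 * (y^T *m (A *m x)) 0 0 + quad A y.
Proof.
move=> symA; have xy : x^T *m A *m y = (y^T *m (A *m x))^T.
  by rewrite !trmx_mul trmxK symA.
rewrite /quad [(x + y)^T]raddfD /= !mulmxDl !mulmxDr xy -(mulmxA y^T) !mxE; ring.
Qed.

Lemma quadZ A (a : R) x : quad A (a *: x) = a ^+ 2 * quad A x.
Proof.
by rewrite /quad [(a *: x)^T]linearZ /= -!scalemxAl -scalemxAr !mxE mulrA expr2.
Qed.

Lemma mul_const_mx0 m p (B : 'M[R]_(m, p)) (c : R) :
  B *m const_mx 1 = 0 :> 'cV_m -> B *m const_mx c = 0 :> 'cV_m.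
Proof.
move=> B1; have -> : const_mx c = c *: const_mx 1 :> 'cV[R]_p.
  by apply/matrixP=> i j; rewrite !mxE mulr1.
by rewrite -scalemxAr B1 scaler0.
Qed.

Lemma quad_const A (c : R) : A *m const_mx 1 = 0 :> 'cV_n ->
  quad A (const_mx c) = 0.
Proof. by move=> A1; rewrite /quad -mulmxA mul_const_mx0 ?mulmx0 ?mxE. Qed.

Lemma quad_shift A x (c : R) : A^T = A -> A *m const_mx 1 = 0 :> 'cV_n ->
  quad A (x - const_mx c) = quad A x.
Proof.
move=> symA A1; rewrite -[in RHS](subrK (const_mx c) x).
have cA : (const_mx c : 'cV_n)^T *m A = 0.
  by apply: trmx_inj; rewrite trmx_mul trmxK symA mul_const_mx0 ?trmx0.
rewrite (quadD _ (const_mx c)) // [_^T *m _]mulmxA cA mul0mx mxE mulr0 addr0.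
by rewrite quad_const ?addr0.
Qed.

(** Subtract from x its value at v: the form does not see the shift, and the
    shifted vector vanishes at v. *)
Lemma pos_mod_const_grounded A v : A^T = A -> A *m const_mx 1 = 0 :> 'cV_n ->
  pos_on A (~: [set v]) -> pos_mod_const A.
Proof.
move=> symA A1 posA x xNc; rewrite -(quad_shift x (x v 0)) //; apply: posA.
  by move=> i; rewrite !inE negbK => /eqP ->; rewrite !mxE subrr.
by rewrite subr_eq0.
Qed.

(** The only constant vector that vanishes somewhere is 0. *)
Lemma pos_mod_const_on A S : S != setT -> pos_mod_const A -> pos_on A S.
Proof.
rewrite eqEsubset subsetT /= => /subsetPn[v _ vS] posA x xS xN0.
apply: posA => c; apply: contra xN0 => /eqP xc; have := xS v vS.
by rewrite xc mxE => ->; apply/eqP/matrixP=> i j; rewrite !mxE.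
Qed.

Lemma quad_ge0 A x : A *m const_mx 1 = 0 :> 'cV_n -> pos_mod_const A ->
  0 <= quad A x.
Proof.
move=> A1 posA; have [[c /eqP ->]|xN] := pselect (exists c, x == const_mx c).
  by rewrite quad_const.
by apply/ltW/posA=> c; apply/negP=> xc; apply: xN; exists c.
Qed.

(** A zero of a nonnegative form is a minimum, so the gradient 2 A x vanishes
    there: otherwise a small step against A x would make the form negative. *)
Lemma psd_quad0 A x : A^T = A -> (forall y, 0 <= quad A y) ->
  quad A x = 0 -> A *m x = 0.
Proof.
move=> symA psdA Qx0; set g := A *m x.
pose q := quad A g; pose N : R := (g^T *m g) 0 0.
have q0 : 0 <= q by apply: psdA.
have q1 : 0 < q + 1 by rewrite ltr_wpDl.
apply/eqP; rewrite -norm2_eq0 -/N eq_le norm2_ge0 andbT.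
(* q may vanish, hence the step - N / (q + 1) instead of the minimizer - N / q. *)
have := psdA (x + (- N / (q + 1)) *: g).
rewrite quadD // quadZ Qx0 add0r [(_ *: g)^T]linearZ /= -scalemxAl mxE -/g -/N -/q.
rewrite -(pmulr_rge0 _ (exprn_gt0 2 q1)).
have -> : (q + 1) ^+ 2 * (2 * (- N / (q + 1) * N) + (- N / (q + 1)) ^+ 2 * q)
   = - (N ^+ 2 * (q + 2)) by field; rewrite gt_eqF.
rewrite oppr_ge0 pmulr_lle0 ?ltr_wpDl // => N2.
by move: N2; rewrite real_exprn_even_le0 ?num_real //= => /eqP ->.
Qed.

End QuadraticForms.

Lemma unitmx_inj (F : fieldType) m (A : 'M[F]_m) :
  (forall x : 'cV_m, A *m x = 0 -> x = 0) -> A \in unitmx.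
Proof.
move=> injA; rewrite -unitmx_tr -row_free_unit; apply: inj_row_free => v vA.
apply: trmx_inj; rewrite trmx0; apply: injA.
by apply: trmx_inj; rewrite trmx_mul trmxK vA trmx0.
Qed.

Lemma unitmx_quad (R : realFieldType) m (A : 'M[R]_m) :
  (forall x, x != 0 -> 0 < quad A x) -> A \in unitmx.
Proof.
move=> posA; apply: unitmx_inj => x Ax0; apply/eqP/negPn/negP => /posA.
by rewrite /quad -mulmxA Ax0 mulmx0 mxE ltxx.
Qed.

(** * Principal submatrices as restrictions of the form *)

Section Selection.
Variables (R : realType) (n : nat).
Implicit Types (A : 'M[R]_n) (x : 'cV[R]_n) (S X Y : {set 'I_n}).

(** The inclusion of the coordinates in S, which turns the reindexing by
    enum_val into matrix products. *)
Definition sel S : 'M[R]_(n, #|S|) := \matrix_(i, j) (i == enum_val j)%:R.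

Lemma submatE A X Y : submat A X Y = (sel X)^T *m A *m sel Y.
Proof.
apply/matrixP=> i j; rewrite !mxE (bigD1 (enum_val j)) //= big1 => [|k kj].
  rewrite !mxE eqxx mulr1 addr0 (bigD1 (enum_val i)) //= big1 => [|k ki].
    by rewrite !mxE eqxx mul1r addr0.
  by rewrite !mxE (negPf ki) mul0r.
by rewrite !mxE (negPf kj) mulr0.
Qed.

Lemma sel_off S (y : 'cV_#|S|) i : i \notin S -> (sel S *m y) i 0 = 0.
Proof.
move=> iS; rewrite mxE big1 // => j _; rewrite mxE.
case: eqP => [ij|]; last by rewrite mul0r.
by rewrite ij enum_valP in iS.
Qed.

Lemma sel_val S (y : 'cV_#|S|) j : (sel S *m y) (enum_val j) 0 = y j 0.
Proof.
rewrite mxE (bigD1 j) //= big1 => [|k kj]; first by rewrite mxE eqxx mul1r addr0.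
by rewrite mxE (inj_eq enum_val_inj) eq_sym (negPf kj) mul0r.
Qed.

Lemma sel_restrict S x : (forall i, i \notin S -> x i 0 = 0) ->
  x = sel S *m \col_j x (enum_val j) 0.
Proof.
move=> xS; apply/matrixP=> i j; rewrite [j]ord1.
have [iS|iNS] := boolP (i \in S); last by rewrite xS ?sel_off.
by rewrite -(enum_rankK_in iS iS) sel_val mxE.
Qed.

Lemma quad_submat A S (y : 'cV_#|S|) : quad (submat A S S) y = quad A (sel S *m y).
Proof. by rewrite /quad submatE trmx_mul !mulmxA. Qed.

Lemma sel_eq0 S (y : 'cV_#|S|) : (sel S *m y == 0) = (y == 0).
Proof.
apply/eqP/eqP=> [Sy|->]; last by rewrite mulmx0.
by apply/matrixP=> i j; rewrite [j]ord1 -sel_val Sy !mxE.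
Qed.

Lemma pos_def_submatP A S : A^T = A ->
  (pos_def (submat A S S) <-> pos_on A S).
Proof.
move=> symA; split=> [[_ posA] x /sel_restrict -> | posA].
  by rewrite sel_eq0 -quad_submat => /posA.
split=> [|y yN0]; first by rewrite submatE !trmx_mul trmxK symA mulmxA.
by rewrite -/(quad _ y) quad_submat; apply: posA => [i /sel_off->|]; rewrite ?sel_eq0.
Qed.

Lemma pos_on_unit A S : pos_on A S -> submat A S S \in unitmx.
Proof.
move=> posA; apply: unitmx_quad => y yN0.
by rewrite quad_submat; apply: posA => [i /sel_off->|]; rewrite ?sel_eq0.
Qed.

End Selection.

(** * Effective conductance as the energy of a potential *)

Section HarmonicExtension.
Variables (R : realType) (n : nat) (A : 'M[R]_n) (symA : A^T = A).
Variables Va Vb : {set 'I_n}.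
Let Vc := rest Va Vb.

(** For disjoint Va and Vb and invertible A_cc, the solution x of the Dirichlet
    problem x = 1 on Va, x = 0 on Vb, (A x)_c = 0 on the remaining nodes c. *)
Definition potential : 'cV[R]_n :=
  sel R Va *m const_mx 1
  - sel R Vc *m (invmx (submat A Vc Vc) *m (submat A Vc Va *m const_mx 1)).

Lemma potential_a i : i \in Va -> potential i 0 = 1.
Proof.
move=> ia; rewrite mxE [X in _ + X]mxE [X in _ - X]sel_off ?inE ?ia // subr0.
by rewrite -(enum_rankK_in ia ia) sel_val mxE.
Qed.

Lemma potential_b i : i \notin Va -> i \in Vb -> potential i 0 = 0.
Proof.
by move=> ia ib; rewrite mxE [X in _ + X]mxE !sel_off ?subr0 ?inE ?ib ?orbT.
Qed.

Hypothesis unitA : submat A Vc Vc \in unitmx.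

Lemma potential_harmonic : (sel R Vc)^T *m (A *m potential) = 0.
Proof.
rewrite !mulmxBr !mulmxA -!submatE -!mulmxA.
by rewrite [X in _ - X]mulKVmx ?subrr.
Qed.

(** Orthogonality, for the bilinear form of A, of the potential to every vector
    that leaves its boundary values unchanged. *)
Lemma potential_harmonic_off (x : 'cV[R]_n) : (forall i, i \notin Vc -> x i 0 = 0) ->
  x^T *m (A *m potential) = 0.
Proof.
by move=> /sel_restrict xc; rewrite xc trmx_mul -mulmxA potential_harmonic mulmx0.
Qed.

(** The energy of the potential p is e_a^T A p, because its interior part is
    orthogonal to p; eliminating the interior values from A p on Va gives
    exactly the block aa of the Schur complement. *)
Lemma g_eff_quad : g_eff A Va Vb = quad A potential.
Proof.
have trA X Y : (submat A X Y)^T = submat A Y X.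
  by rewrite !submatE !trmx_mul trmxK symA mulmxA.
rewrite /quad /g_eff; congr ((_ : 'M_1) 0 0).
rewrite -[RHS]mulmxA {1}/potential [(_ - _)^T]raddfB mulmxBl /=.
rewrite [X in _ = _ - X]potential_harmonic_off ?subr0; last first.
  by move=> i /sel_off ->.
have -> : ind_a R Va Vb = col_mx (const_mx 1) 0 by [].
rewrite /schur -/Vc !trA tr_col_mx !mulmxBr !mulmxBl trmx_const trmx0.
rewrite mul_row_block !mul0mx !addr0 mul_row_col mulmx0 addr0.
rewrite !mulmxA mul_row_col mul0mx addr0.
rewrite -(mulmxA _ (row_mx _ _)) mul_row_col mulmx0 addr0.
rewrite trmx_mul trmx_const.
by rewrite !submatE !mulmxA.
Qed.

End HarmonicExtension.

Section Conductance.
Variables (R : realType) (n : nat) (A : 'M[R]_n) (symA : A^T = A).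

Lemma pos_on_sub (S T : {set 'I_n}) : S \subset T -> pos_on A T -> pos_on A S.
Proof.
move=> sST posA x xS; apply: posA => i; apply: contraNeq => xi.
by apply: (subsetP sST); apply: contraNT xi => /xS ->.
Qed.

(** The boundary value of x at v determines the multiple x_v p of the potential
    to subtract; what remains is supported on the interior, and the form
    splits as x_v^2 g_eff + quad A z without a cross term. *)
Lemma pos_on_grow v (Vb : {set 'I_n}) : v \notin Vb ->
  pos_on A (rest [set v] Vb) -> g_eff_gt0 A [set v] Vb -> pos_on A (~: Vb).
Proof.
move=> vb posA [unitA]; rewrite g_eff_quad // => g0 x xb xN0.
set p := potential _ _ _ in g0; pose z := x - x v 0 *: p.
have zE i : z i 0 = x i 0 - x v 0 * p i 0 by rewrite !mxE.
have zc i : i \notin rest [set v] Vb -> z i 0 = 0.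
  rewrite zE !inE negbK => /orP[/eqP ->|ib].
    by rewrite potential_a ?inE // mulr1 subrr.
  have iv : i \notin [set v] by rewrite inE; apply: contraNneq vb => <-.
  by rewrite potential_b // mulr0 subr0 xb // inE negbK.
have -> : x = x v 0 *: p + z by rewrite addrC subrK.
rewrite quadD // quadZ -scalemxAr [X in _ + _ * X + _](_ : _ = 0); last first.
  by rewrite -scalemxAr potential_harmonic_off // scaler0 mxE.
rewrite mulr0 addr0.
have [xv0|xv0] := eqVneq (x v 0) 0.
  rewrite xv0 expr0n mul0r add0r posA //; apply: contra xN0 => /eqP z0.
  by apply/eqP; rewrite -z0 /z xv0 scale0r subr0.
have zz : 0 <= quad A z.
  have [->|zN0] := eqVneq z 0; first by rewrite /quad mulmx0 mxE.
  exact: ltW (posA z zc zN0).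
by rewrite ltr_pwDl // mulr_gt0 // lt0r sqrf_eq0 xv0 sqr_ge0.
Qed.

Lemma g_eff_gt0_pos_on (Va Vb : {set 'I_n}) : Va != set0 -> [disjoint Va & Vb] ->
  pos_on A (~: Vb) -> g_eff_gt0 A Va Vb.
Proof.
move=> /set0Pn[v va] dab posA.
have unitA : submat A (rest Va Vb) (rest Va Vb) \in unitmx.
  by apply: pos_on_unit; apply: pos_on_sub posA; rewrite setCS subsetUr.
split=> //; rewrite g_eff_quad //; apply: posA => [i|].
  rewrite inE negbK => ib; apply: potential_b => //.
  by rewrite (disjointFl dab).
apply/eqP=> /matrixP/(_ v 0)/eqP.
by rewrite potential_a // mxE oner_eq0.
Qed.

End Conductance.

(** * Multiplicity of the zero eigenvalue *)

Section Multiplicity.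

(** Similarity in the form A S = S B, which needs no inverse of S. *)
Lemma char_poly_intertwine (F : idomainType) m (A B S : 'M[F]_m) :
  \det S != 0 -> A *m S = S *m B -> char_poly A = char_poly B.
Proof.
move=> detS AS; set S' := map_mx polyC S.
have dS' : \det S' != 0 by rewrite det_map_mx polyC_eq0.
apply: (mulIf dS'); rewrite [RHS]mulrC -!det_mulmx; congr (\det _).
by rewrite mulmxBl mulmxBr scalar_mxC -!map_mxM AS.
Qed.

Lemma char_poly_ublock (F : comNzRingType) p q (A : 'M[F]_p) (B : 'M_(p, q)) D :
  char_poly (block_mx A B 0 D) = char_poly A * char_poly D.
Proof.
rewrite -(det_ublock _ (- map_mx polyC B)); congr (\det _).
rewrite /char_poly_mx map_block_mx/= map_mx0 scalar_mx_block opp_block_mx.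
by rewrite add_block_mx oppr0 addr0 sub0r.
Qed.

Lemma unitmx_add_ones (R : realFieldType) m :
  1%:M + const_mx 1 *m (const_mx 1 : 'rV_m) \in @unitmx R m.
Proof.
apply: unitmx_quad => x xN0.
have -> : quad (1%:M + const_mx 1 *m (const_mx 1 : 'rV_m)) x =
   (x^T *m x) 0 0 + ((const_mx 1 *m x : 'cV_1)^T *m (const_mx 1 *m x)) 0 0.
  by rewrite /quad mulmxDr mulmx1 mulmxDl trmx_mul trmx_const !mulmxA mxE.
by rewrite ltr_pwDl ?norm2_ge0 // lt0r norm2_eq0 xN0 norm2_ge0.
Qed.

(** After the change of basis that replaces the first basis vector by the vector
    of ones, L becomes block triangular with diagonal blocks 0 and M.  Zero
    row and column sums give M = (I + J) D, where J is the all-ones matrix and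
    D is L without its first row and column.  So the characteristic polynomial
    is X times that of M, and 0 is a simple root iff M, equivalently D, is
    invertible.  This avoids diagonalizing L. *)
Lemma simple0_reduced (R : realType) m (L : 'M[R]_(1 + m)) :
  L *m const_mx 1 = 0 :> 'cV_(1 + m) -> const_mx 1 *m L = 0 :> 'rV_(1 + m) ->
  simple_eigenvalue L 0 <-> drsubmx L \in unitmx.
Proof.
set D := drsubmx L; set b := ursubmx L => L1 L1'.
have J1 : const_mx 1 = 1%:M :> 'M[R]_1.
  by apply/matrixP=> i j; rewrite !mxE !ord1.
have [c0 d0] : ulsubmx L + b *m const_mx 1 = 0 :> 'M_1 /\
               dlsubmx L + D *m const_mx 1 = 0 :> 'cV_m.
  move: L1; rewrite -{1}(submxK L) -(col_mx_const _ m 1 1) mul_block_col.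
  by rewrite -{1}col_mx0 => /eq_col_mx; rewrite J1 !mulmx1.
have bE : b = - (const_mx 1 *m D).
  move: L1'; rewrite -{1}(submxK L) -(row_mx_const 1 1 m) mul_row_block.
  by rewrite -{1}row_mx0 => /eq_row_mx[_ /eqP]; rewrite J1 mul1mx addr_eq0 => /eqP.
pose S : 'M[R]_(1 + m) := block_mx 1%:M 0 (const_mx 1) 1%:M.
pose M := (1%:M + const_mx 1 *m (const_mx 1 : 'rV_m)) *m D.
have dS : \det S != 0 by rewrite det_lblock !det1 mulr1 oner_eq0.
have LS : L *m S = S *m block_mx 0 b 0 M.
  rewrite -{1}(submxK L) !mulmx_block !mulmx1 !mulmx0 !mul0mx !mul1mx !add0r.
  rewrite c0 d0 addr0 -/b -/D /M mulmxDl mul1mx.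
  by rewrite {3}bE mulmxN mulmxA [X in _ = block_mx _ _ _ X]addrC addrK.
have -> : (D \in unitmx) = (~~ root (char_poly M) 0).
  rewrite /root horner_coef0 char_poly_det mulf_eq0 signr_eq0 /= -unitfE.
  by rewrite -unitmxE unitmx_mul unitmx_add_ones.
rewrite /simple_eigenvalue (char_poly_intertwine dS LS) char_poly_ublock.
have -> : char_poly (0 : 'M[R]_1) = ('X - 0%:P) ^+ 1.
  by rewrite /char_poly det_mx11 !mxE expr1 mulr1n polyC0.
(* The root 0 of the first factor has multiplicity 1; it remains to see that
   the second factor does not have this root. *)
rewrite mupM ?mup_XsubCX ?eqxx ?expf_neq0 ?polyXsubC_eq0 //; last first.
  by rewrite monic_neq0 // char_poly_monic.
have MN0 : char_poly M != 0 by rewrite monic_neq0 // char_poly_monic.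
rewrite -dvdp_XsubCl XsubC_dvd // -eqn0Ngt add1n.
split=> [[->]//|/eqP ->//].
Qed.

(** Both sides say that the form is nonnegative and that D, the matrix L without
    its first row and column, has a trivial kernel: D represents the form on
    the vectors vanishing at the first node. *)
Lemma psd_simple0P (R : realType) n (L : 'M[R]_n) : (0 < n)%N ->
  L^T = L -> L *m const_mx 1 = 0 :> 'cV_n ->
  pos_semidef L /\ simple_eigenvalue L 0 <-> pos_mod_const L.
Proof.
case: n L => // m; rewrite -[m.+1]/(1 + m)%N => L _ symL L1.
have L1' : const_mx 1 *m L = 0 :> 'rV_(1 + m).
  by apply: trmx_inj; rewrite trmx_mul symL trmx_const L1 trmx0.
have redL := simple0_reduced L1 L1'.
have Dcol (y : 'cV_m) : L *m (col_mx 0 y) =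
    col_mx (ursubmx L *m y) (drsubmx L *m y).
  by rewrite -{1}(submxK L) mul_block_col !mulmx0 !add0r.
split=> [[[_ psdL] /redL unitD]|posL].
  apply: (@pos_mod_const_grounded _ _ _ (lshift m ord0)) => // x x0 xN0.
  rewrite lt0r psdL andbT; apply: contra xN0 => /eqP Qx0.
  have Lx := psd_quad0 symL psdL Qx0.
  have xE : x = col_mx 0 (dsubmx x).
    rewrite -{1}(vsubmxK x); congr col_mx.
    apply/matrixP=> i j; rewrite [i]ord1 [j]ord1 !mxE.
    by rewrite x0 // !inE negbK.
  move: Lx; rewrite xE Dcol -{1}col_mx0 => /eq_col_mx[_ Dx].
  by rewrite -(mulKmx unitD (dsubmx _)) Dx mulmx0 col_mx0.
split; first by split=> // x; apply: quad_ge0.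
apply/redL; apply: unitmx_quad => y yN0.
have -> : quad (drsubmx L) y = quad L (col_mx 0 y).
  by rewrite /quad -[in RHS]mulmxA Dcol tr_col_mx mul_row_col trmx0 mul0mx add0r mulmxA.
apply: posL => c; apply: contra yN0 => /eqP yc; apply/eqP/matrixP=> i j.
have := congr1 (fun M : 'M_(1 + m, 1) => M (lshift m 0) 0) yc.
have := congr1 (fun M : 'M_(1 + m, 1) => M (rshift 1 i) j) yc.
by rewrite col_mxEd col_mxEu !mxE => -> <-.
Qed.

End Multiplicity.

(** * Sequential inclusions *)

Section SequentialInclusion.
Variable T : finType.
Implicit Types (U : {set T}) (F : nat -> {set T}).

Lemma card_sequential_inclusion U F k : sequential_inclusion U F ->
  (1 <= k <= #|U|)%N -> #|F k| = k.
Proof.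
move=> [incF FU]; set m := #|U| => /andP[k0 km].
rewrite -(subKn km); have : (m - k < m)%N by rewrite ltn_subrL k0 (leq_trans k0).
elim: (m - k)%N => [|d IHd] dm; first by rewrite subn0 FU.
have [|_] := incF (m - d.+1)%N; first by rewrite subn_gt0 dm ltn_subrL (leq_ltn_trans _ dm).
by rewrite subnSK ?(ltnW dm) // IHd ?(ltnW dm) // -(subnSK (ltnW dm)) => -[].
Qed.

Lemma sequential_inclusion_step U F k : sequential_inclusion U F ->
  (1 <= k < #|U|)%N ->
  exists v, [/\ v \notin F k, F k.+1 :\: F k = [set v] & F k.+1 = v |: F k].
Proof.
move=> [incF _] /incF[sF cF].
have /cards1P[v vE] : #|F k.+1 :\: F k| == 1%N.
  by rewrite cardsD (setIidPr sF) cF subSnn.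
have : v \in F k.+1 :\: F k by rewrite vE inE.
rewrite inE => /andP[vF _]; exists v; split=> //.
by rewrite -vE setUC -{1}(setID (F k.+1) (F k)) (setIidPr sF).
Qed.

Lemma sequential_inclusion_exists U : exists F, sequential_inclusion U F.
Proof.
exists (fun k => [set x in take k (enum U)]); split=> [k /andP[_ kU]|]; last first.
  by apply/setP=> x; rewrite inE cardE take_size mem_enum.
have card_take j : (j <= #|U|)%N -> #|[set x in take j (enum U)]| = j.
  move=> jU; rewrite cardsE; move/card_uniqP: (take_uniq j (enum_uniq (mem U))) => ->.
  by rewrite size_takel // -cardE.
rewrite !card_take // 1?ltnW //; split=> //.
apply/subsetP=> x; rewrite !inE => xk.
have -> : take k.+1 (enum U) = take k (enum U) ++ take 1 (drop k (enum U)).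
  by rewrite -takeD addn1.
by rewrite mem_cat xk.
Qed.

End SequentialInclusion.

Section ConductanceChain.
Variables (R : realType) (n : nat) (A : 'M[R]_n) (symA : A^T = A).
Implicit Types (U : {set 'I_n}) (F : nat -> {set 'I_n}).

(** Positivity spreads from the complement of U to the complement of F k for
    decreasing k, and F 1 is a singleton. *)
Lemma pos_on_chain U F : U != set0 -> sequential_inclusion U F ->
  (forall k, (1 <= k < #|U|)%N -> g_eff_gt0 A (F k.+1 :\: F k) (F k)) ->
  pos_on A (~: U) -> exists v, pos_on A (~: [set v]).
Proof.
rewrite -card_gt0 => U0 incF gF posU.
suff posF k : (1 <= k <= #|U|)%N -> pos_on A (~: F k).
  have /eqP/cards1P[v F1] := card_sequential_inclusion incF (k := 1) U0.
  by exists v; rewrite -F1; apply: posF.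
(* The descent on k is an induction on d = #|U| - k. *)
move=> /andP[k0 km]; rewrite -(subKn km).
have : (#|U| - k < #|U|)%N by rewrite ltn_subrL k0.
elim: (#|U| - k)%N => [_|d IHd dm]; first by rewrite subn0 (proj2 incF).
set j := (#|U| - d.+1)%N.
have jE : (#|U| - d)%N = j.+1 by rewrite /j subnSK // ltnW.
have jU : (1 <= j < #|U|)%N by rewrite subn_gt0 dm ltn_subrL.
have [v [vF vD FvE]] := sequential_inclusion_step incF jU.
apply: (pos_on_grow symA vF); last by rewrite -vD; apply: gF.
by rewrite /rest -FvE -jE; apply/IHd/ltnW.
Qed.

Lemma pos_mod_const_g_eff U F k : pos_mod_const A -> sequential_inclusion U F ->
  (1 <= k < #|U|)%N -> g_eff_gt0 A (F k.+1 :\: F k) (F k).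
Proof.
move=> posA incF kU; have [v [vF -> _]] := sequential_inclusion_step incF kU.
apply: g_eff_gt0_pos_on => //.
- by apply/set0Pn; exists v; rewrite inE.
- by rewrite disjoints1.
- apply: pos_mod_const_on => //; rewrite -setC0 (inj_eq (@setC_inj _)) -card_gt0.
  have /andP[k0 km] := kU.
  by rewrite (card_sequential_inclusion incF) // k0 ltnW.
Qed.

End ConductanceChain.

(** * Laplacians of signed graphs *)

Section Laplacian.
Variables (R : realType) (n l : nat) (G : signed_graph R n l).
Implicit Type x : 'cV[R]_n.

Lemma incidence_mulE x e :
  ((incidence G)^T *m x) e 0 = x (src G e) 0 - x (dst G e) 0.
Proof.
have sd := src_neq_dst G e.
rewrite mxE (bigD1 (src G e)) //= (bigD1 (dst G e)) 1?eq_sym //= big1.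
  by rewrite !mxE eqxx eq_sym (negPf sd) eqxx mul1r mulN1r addr0.
by move=> i /andP[/negPf is_ /negPf id_]; rewrite !mxE is_ id_ mul0r.
Qed.

Lemma laplacian_sym : (laplacian G)^T = laplacian G.
Proof. by rewrite /laplacian !trmx_mul trmxK tr_diag_mx mulmxA. Qed.

Lemma laplacian_const : laplacian G *m const_mx 1 = 0 :> 'cV_n.
Proof.
rewrite /laplacian -mulmxA [X in _ *m X](_ : _ = 0) ?mulmx0 //.
by apply/matrixP=> e j; rewrite [j]ord1 incidence_mulE !mxE subrr.
Qed.

Lemma quad_laplacian x :
  quad (laplacian G) x = \sum_e wt G e * (x (src G e) 0 - x (dst G e) 0) ^+ 2.
Proof.
rewrite /quad /laplacian !mulmxA -(mulmxA _ _ x) -[x^T *m _]trmxK trmx_mul trmxK.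
rewrite mxE; apply: eq_bigr => e _; rewrite incidence_mulE.
by rewrite mul_mx_diag !mxE -incidence_mulE mxE expr2; ring.
Qed.

(** The level set of x through one node is closed under adjacency. *)
Lemma connected_const x : connected_graph G ->
  (forall e, x (src G e) 0 = x (dst G e) 0) -> exists c, x = const_mx c.
Proof.
move=> [n0 conn] xe; pose v := Ordinal n0; exists (x v 0).
have xadj i j : adjacent G i j -> x i 0 = x j 0.
  move=> /existsP[e /eqP eij].
  have : i \in ends G e by rewrite eij !inE eqxx.
  have : j \in ends G e by rewrite eij !inE eqxx orbT.
  by rewrite !inE => /orP[]/eqP -> /orP[]/eqP ->; rewrite ?xe.
apply/matrixP=> i j; rewrite [j]ord1 mxE.
have clo : closed (adjacent G) [pred k | x k 0 == x v 0].
  by move=> a b /xadj xab; rewrite !inE xab.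
have := closed_connect clo (conn v i); rewrite !inE eqxx.
by move=> /esym/eqP.
Qed.

(** A negative edge contributes 0 because x vanishes at both of its ends, so the
    edge sum is a sum of nonnegative terms; it vanishes only if x is constant
    along every edge. *)
Lemma quad_laplacian_gt0 x : connected_graph G ->
  (forall i, i \in negative_nodes G -> x i 0 = 0) ->
  (forall c, x != const_mx c) -> 0 < quad (laplacian G) x.
Proof.
move=> conn x0 xN; rewrite quad_laplacian.
have term_ge0 e : 0 <= wt G e * (x (src G e) 0 - x (dst G e) 0) ^+ 2.
  have [w_ge0|w_lt0] := leP 0 (wt G e); first by rewrite mulr_ge0 ?sqr_ge0.
  have Ve i : i \in ends G e -> x i 0 = 0.
    by move=> ie; apply: x0; rewrite inE; apply/existsP; exists e; rewrite ie.
  by rewrite !Ve ?inE ?eqxx ?orbT // subrr expr0n mulr0.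
rewrite lt0r sumr_ge0 ?andbT //; apply/negP.
rewrite psumr_eq0 // => /allP term0.
have [e|c xc] := connected_const (x := x) conn.
  have := term0 e (mem_index_enum _).
  by rewrite /= mulf_eq0 (negPf (wt_neq0 G e)) sqrf_eq0 subr_eq0 => /eqP.
by have := xN c; rewrite xc eqxx.
Qed.

Lemma pos_on_laplacian : connected_graph G -> negative_nodes G != set0 ->
  pos_on (laplacian G) (~: negative_nodes G).
Proof.
move=> conn /set0Pn[v vneg] x x0 xN.
have {}x0 i : i \in negative_nodes G -> x i 0 = 0.
  by move=> ineg; apply: x0; rewrite inE negbK.
apply: quad_laplacian_gt0 => // c; apply: contra xN => /eqP xc.
have := x0 v vneg; rewrite xc mxE => ->.
by apply/eqP/matrixP=> i j; rewrite !mxE.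
Qed.

End Laplacian.

(** * The equivalence *)

Theorem theorem6 (R : realType) (n l : nat) (G : signed_graph R n l)
    (conn : connected_graph G) :
  let L := laplacian G in
  let Vm := negative_nodes G in
  let a := pos_semidef L /\ simple_eigenvalue L 0 in
  let b := exists F : nat -> {set 'I_n},
    sequential_inclusion Vm F /\
    forall k : nat, (1 <= k < #|Vm|)%N ->
      g_eff_gt0 L (F k.+1 :\: F k) (F k) in
  let c := exists (Vo : {set 'I_n}) (F : nat -> {set 'I_n}),
    [/\ Vo != [set: 'I_n],
        sequential_inclusion (~: Vo) F,
        pos_def (submat L Vo Vo) &
        forall k : nat, (1 <= k < #|~: Vo|)%N ->
          g_eff_gt0 L (F k.+1 :\: F k) (F k)] in
  (a <-> b) /\ (a <-> c).
Proof.
move=> L Vm a b c.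
have symL : L^T = L := laplacian_sym G.
have L1 : L *m const_mx 1 = 0 :> 'cV_n := laplacian_const G.
have n0 : (0 < n)%N by case: conn.
have aP : a <-> pos_mod_const L := psd_simple0P n0 symL L1.
have chain_pos (U : {set 'I_n}) F : U != set0 -> sequential_inclusion U F ->
    (forall k, (1 <= k < #|U|)%N -> g_eff_gt0 L (F k.+1 :\: F k) (F k)) ->
    pos_on L (~: U) -> pos_mod_const L.
  move=> U0 incF gF /(pos_on_chain symL U0 incF gF)[v].
  exact: pos_mod_const_grounded.
split; split=> [/aP posL|].
- have [F incF] := sequential_inclusion_exists Vm.
  by exists F; split=> // k; apply: pos_mod_const_g_eff.
- move=> [F [incF gF]]; apply/aP.
  have [Vm0|Vm_neq0] := eqVneq Vm set0.
    (* All weights are positive: the edge sum is positive off the constants. *)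
    move=> x; apply: quad_laplacian_gt0 => // i.
    by rewrite -/Vm Vm0 inE.
  exact: chain_pos Vm_neq0 incF gF (pos_on_laplacian conn Vm_neq0).
- (* Grounding a single node leaves no conductance to test. *)
  exists (~: [set Ordinal n0]), (fun=> [set Ordinal n0]).
  have Vo_neqT : ~: [set Ordinal n0] != setT.
    by rewrite -setC0 (inj_eq (@setC_inj _)) -card_gt0 cards1.
  split=> //.
  + by split; rewrite setCK // cards1 => k /andP[k1 /(leq_ltn_trans k1)].
  + by apply/pos_def_submatP => //; apply: pos_mod_const_on.
  + by rewrite setCK cards1 => k /andP[k1 /(leq_ltn_trans k1)].
- move=> [Vo [F [VoT incF posVo gF]]]; apply/aP.
  apply: (chain_pos (~: Vo) F) => //.
    by rewrite -(inj_eq (@setC_inj _)) setCK setC0.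
  by rewrite setCK; apply/pos_def_submatP.
Qed.
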